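(* Let $\lambda>0$ and let $\bar\zeta=(\bar x,\bar y,\bar z,\bar u,\bar v,\bar w)\in\mathbb{R}^n\times\mathbb{R}^m\times\mathbb{R}^m\times\mathbb{R}^p\times\mathbb{R}^q\times\mathbb{R}^q$ satisfy the stationarity system with parameter $\lambda$. Suppose that (i) (ULICQ at $(\bar x,\bar y)$) the family $\{\nabla G_i(\bar x,\bar y): G_i(\bar x,\bar y)=0\}\cup\{\nabla g_j(\bar x,\bar y): g_j(\bar x,\bar y)=0\}$ of vectors in $\mathbb{R}^{n+m}$ is linearly independent; (ii) (LLICQ at $(\bar x,\bar z)$) the family $\{\nabla_2 g_j(\bar x,\bar z): g_j(\bar x,\bar z)=0\}$ is linearly independent; (iii) for all $d\in Q(\bar x,\bar y,\bar z)\setminus\{0\}$, $$(d^{1,2})^\top\nabla^2\mathcal{L}^\lambda(\bar\zeta)\,d^{1,2}>\lambda\,(d^{1,3})^\top\nabla^2\ell(\bar\zeta)\,d^{1,3};$$ (iv) (LSCC at $(\bar x,\bar z,\bar w)$) $\{j\mid\bar w_j=g_j(\bar x,\bar z)=0\}=\emptyset$. Then $\Phi^\lambda$ is CD-regular at $\bar\zeta$, i.e., every matrix in the Clarke generalized Jacobian $\partial\Phi^\lambda(\bar\zeta)$ is nonsingular.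
   Context: The functions $F,f:\mathbb{R}^n\times\mathbb{R}^m\to\mathbb{R}$, $G:\mathbb{R}^n\times\mathbb{R}^m\to\mathbb{R}^p$ and $g:\mathbb{R}^n\times\mathbb{R}^m\to\mathbb{R}^q$ are twice continuously differentiable. $\nabla_1,\nabla_2$ denote gradients with respect to the first (in $\mathbb{R}^n$) and second (in $\mathbb{R}^m$) variable, and $\nabla$ the gradient with respect to both. Define $\ell(x,z,w):=f(x,z)+w^\top g(x,z)$, $\mathcal{L}^\lambda(x,y,u,v):=F(x,y)+u^\top G(x,y)+v^\top g(x,y)+\lambda f(x,y)$, and $L^\lambda(x,y,z,u,v,w):=\mathcal{L}^\lambda(x,y,u,v)-\lambda\ell(x,z,w)$. $\nabla^2\mathcal{L}^\lambda(\bar\zeta)$ is the Hessian of $\mathcal{L}^\lambda$ with respect to $(x,y)$ at $(\bar x,\bar y,\bar u,\bar v)$, and $\nabla^2\ell(\bar\zeta)$ is the Hessian of $\ell$ with respect to $(x,z)$ at $(\bar x,\bar z,\bar w)$. Stationarity system with parameter $\lambda$ (for $(x,y,z,u,v,w)$): $\nabla_{(x,y,z)}L^\lambda(x,y,z,u,v,w)=0$; $u\ge0$, $G(x,y)\le0$, $u^\top G(x,y)=0$; $v\ge0$, $g(x,y)\le0$, $v^\top g(x,y)=0$; $w\ge0$, $g(x,z)\le0$, $w^\top g(x,z)=0$. With $\phi(a,b):=\sqrt{a^2+b^2}-a-b$ put $\phi^G(x,y,u):=(\phi(-G_i(x,y),u_i))_{i=1}^p$ and $\phi^g(x,y,v):=(\phi(-g_j(x,y),v_j))_{j=1}^q$.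 With $N:=n+2m+p+2q$ and $\zeta=(x,y,z,u,v,w)$, the map $\Phi^\lambda:\mathbb{R}^N\to\mathbb{R}^N$ is $$\Phi^\lambda(\zeta):=\big(\nabla_{(x,y,z)}L^\lambda(\zeta),\ \phi^G(x,y,u),\ \phi^g(x,y,v),\ \phi^g(x,z,w)\big).$$ The Clarke generalized Jacobian $\partial\Phi^\lambda(\bar\zeta)$ is the convex hull of all limits of Jacobians of $\Phi^\lambda$ along sequences of differentiability points converging to $\bar\zeta$. Index sets: $\nu^1:=\{i\mid\bar u_i>0,\,G_i(\bar x,\bar y)=0\}$, $\nu^2:=\{j\mid\bar v_j>0,\,g_j(\bar x,\bar y)=0\}$, $\nu^3:=\{j\mid\bar w_j>0,\,g_j(\bar x,\bar z)=0\}$. For $d=(d^1,d^2,d^3)\in\mathbb{R}^n\times\mathbb{R}^m\times\mathbb{R}^m$ write $d^{1,2}:=(d^1,d^2)$, $d^{1,3}:=(d^1,d^3)$, and $$Q(\bar x,\bar y,\bar z):=\{d\mid\nabla G_i(\bar x,\bar y)^\top d^{1,2}=0\ (i\in\nu^1),\ \nabla g_j(\bar x,\bar y)^\top d^{1,2}=0\ (j\in\nu^2),\ \nabla g_j(\bar x,\bar z)^\top d^{1,3}=0\ (j\in\nu^3)\}.$$ *)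

(* Defs.v *)
From HB Require Import structures.
From mathcomp Require Import all_boot all_order all_algebra.
From mathcomp Require Import all_classical all_reals all_analysis.
Set Implicit Arguments.
Unset Strict Implicit.
Unset Printing Implicit Defensive.
Import Order.TTheory GRing.Theory Num.Theory.
Import numFieldNormedType.Exports.

Local Open Scope classical_set_scope.
Local Open Scope ring_scope.

(* All vectors are row vectors, so that u^T v is u *m v^T and d^T H d is
   d *m H *m d^T. A function on R^n x R^m is curried; a pair (x, y) is
   identified with row_mx x y : 'rV_(n + m), a triple (x, y, z) with
   row_mx (row_mx x y) z. *)

Definition dotv (R : realType) k (a b : 'rV[R]_k) : R := (a *m b^T) 0 0.

Definition quadf (R : realType) k (H : 'M[R]_k) (d : 'rV[R]_k) : R :=
  (d *m H *m d^T) 0 0.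

Definition uncur (R : realType) n m T (h : 'rV[R]_n -> 'rV[R]_m -> T)
  (s : 'rV[R]_(n + m)) : T := h (lsubmx s) (rsubmx s).

Definition grad (R : realType) k (h : 'rV[R]_k -> R) (x : 'rV[R]_k) :
  'rV[R]_k := \row_i 'D_(delta_mx 0 i) h x.

(* The library's 'J acts on row vectors, i.e. ('J h x) i j is the derivative of
   the j-th component of h along the i-th coordinate; hence the (i, j) entry
   below is the second derivative d_i d_j h. *)
Definition hess (R : realType) k (h : 'rV[R]_k -> R) (x : 'rV[R]_k) :
  'M[R]_k := 'J (grad h) x.

Definition twice_cont_diff (R : realType) k (h : 'rV[R]_k -> R) : Prop :=
  [/\ forall x, differentiable h x,
      forall x, differentiable (grad h) x &
      continuous (hess h)].

Definition cpt (R : realType) n m k (h : 'rV[R]_n -> 'rV[R]_m -> 'rV[R]_k)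
  (i : 'I_k) (x : 'rV[R]_n) (y : 'rV[R]_m) : R := h x y 0 i.

Definition ell (R : realType) n m q (f : 'rV[R]_n -> 'rV[R]_m -> R)
  (g : 'rV[R]_n -> 'rV[R]_m -> 'rV[R]_q)
  (x : 'rV[R]_n) (z : 'rV[R]_m) (w : 'rV[R]_q) : R :=
  f x z + dotv w (g x z).

Definition calL (R : realType) n m p q (F f : 'rV[R]_n -> 'rV[R]_m -> R)
  (G : 'rV[R]_n -> 'rV[R]_m -> 'rV[R]_p)
  (g : 'rV[R]_n -> 'rV[R]_m -> 'rV[R]_q) (lambda : R)
  (x : 'rV[R]_n) (y : 'rV[R]_m) (u : 'rV[R]_p) (v : 'rV[R]_q) : R :=
  F x y + dotv u (G x y) + dotv v (g x y) + lambda * f x y.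

Definition Lag (R : realType) n m p q (F f : 'rV[R]_n -> 'rV[R]_m -> R)
  (G : 'rV[R]_n -> 'rV[R]_m -> 'rV[R]_p)
  (g : 'rV[R]_n -> 'rV[R]_m -> 'rV[R]_q) (lambda : R)
  (x : 'rV[R]_n) (y z : 'rV[R]_m)
  (u : 'rV[R]_p) (v w : 'rV[R]_q) : R :=
  calL F f G g lambda x y u v - lambda * ell f g x z w.

Definition grad_xyz_Lag (R : realType) n m p q
  (F f : 'rV[R]_n -> 'rV[R]_m -> R)
  (G : 'rV[R]_n -> 'rV[R]_m -> 'rV[R]_p)
  (g : 'rV[R]_n -> 'rV[R]_m -> 'rV[R]_q) (lambda : R)
  (x : 'rV[R]_n) (y z : 'rV[R]_m)
  (u : 'rV[R]_p) (v w : 'rV[R]_q) : 'rV[R]_(n + m + m) :=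
  grad (uncur (uncur (fun x' y' z' => Lag F f G g lambda x' y' z' u v w)))
    (row_mx (row_mx x y) z).

Definition complementary (R : realType) k (u c : 'rV[R]_k) : Prop :=
  [/\ forall i, 0 <= u 0 i, forall i, c 0 i <= 0 & dotv u c = 0].

Definition stationary (R : realType) n m p q
  (F f : 'rV[R]_n -> 'rV[R]_m -> R)
  (G : 'rV[R]_n -> 'rV[R]_m -> 'rV[R]_p)
  (g : 'rV[R]_n -> 'rV[R]_m -> 'rV[R]_q) (lambda : R)
  (x : 'rV[R]_n) (y z : 'rV[R]_m)
  (u : 'rV[R]_p) (v w : 'rV[R]_q) : Prop :=
  [/\ grad_xyz_Lag F f G g lambda x y z u v w = 0,
      complementary u (G x y),
      complementary v (g x y) &
      complementary w (g x z)].

Definition fischer_burmeister (R : realType) (a b : R) : R :=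
  Num.sqrt (a ^+ 2 + b ^+ 2) - a - b.

Definition phi_vec (R : realType) k (c u : 'rV[R]_k) : 'rV[R]_k :=
  \row_i fischer_burmeister (- c 0 i) (u 0 i).

Definition zeta_of (R : realType) n m p q
  (x : 'rV[R]_n) (y z : 'rV[R]_m) (u : 'rV[R]_p) (v w : 'rV[R]_q) :
  'rV[R]_(n + m + m + (p + q + q)) :=
  row_mx (row_mx (row_mx x y) z) (row_mx (row_mx u v) w).

Definition Phi (R : realType) n m p q
  (F f : 'rV[R]_n -> 'rV[R]_m -> R)
  (G : 'rV[R]_n -> 'rV[R]_m -> 'rV[R]_p)
  (g : 'rV[R]_n -> 'rV[R]_m -> 'rV[R]_q) (lambda : R)
  (zeta : 'rV[R]_(n + m + m + (p + q + q))) :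
  'rV[R]_(n + m + m + (p + q + q)) :=
  let x := lsubmx (lsubmx (lsubmx zeta)) in
  let y := rsubmx (lsubmx (lsubmx zeta)) in
  let z := rsubmx (lsubmx zeta) in
  let u := lsubmx (lsubmx (rsubmx zeta)) in
  let v := rsubmx (lsubmx (rsubmx zeta)) in
  let w := rsubmx (rsubmx zeta) in
  row_mx (grad_xyz_Lag F f G g lambda x y z u v w)
    (row_mx (row_mx (phi_vec (G x y) u) (phi_vec (g x y) v))
            (phi_vec (g x z) w)).

(* The transpose of 'J is the usual Jacobian matrix, whose (i, j) entry is the
   derivative of the i-th component along the j-th coordinate. *)
Definition limiting_jacobians (R : realType) k l
  (H : 'rV[R]_k -> 'rV[R]_l) (x : 'rV[R]_k) : set 'M[R]_(l, k) :=
  [set A | exists s : nat -> 'rV[R]_k,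
     [/\ forall i, differentiable H (s i),
         s i @[i --> \oo] --> x &
         ('J H (s i))^T @[i --> \oo] --> A]].

Definition convex_hull (R : realType) (V : lmodType R) (A : set V) : set V :=
  smallest (@convex_set R V) A.

Definition clarke_jacobian (R : realType) k l
  (H : 'rV[R]_k -> 'rV[R]_l) (x : 'rV[R]_k) : set 'M[R]_(l, k) :=
  convex_hull (limiting_jacobians H x).

Definition CD_regular (R : realType) k
  (H : 'rV[R]_k -> 'rV[R]_k) (x : 'rV[R]_k) : Prop :=
  forall W, clarke_jacobian H x W -> W \in unitmx.

Definition active (R : realType) k (c : 'rV[R]_k) : pred 'I_k :=
  [pred i | c 0 i == 0].

(* [free] on the concatenated sequence is linear independence of the family:
   vectors repeated for different indices are dependent. *)
Definition ULICQ (R : realType) n m p q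
  (G : 'rV[R]_n -> 'rV[R]_m -> 'rV[R]_p)
  (g : 'rV[R]_n -> 'rV[R]_m -> 'rV[R]_q)
  (x : 'rV[R]_n) (y : 'rV[R]_m) : Prop :=
  free ([seq grad (uncur (cpt G i)) (row_mx x y) | i in active (G x y)]
     ++ [seq grad (uncur (cpt g j)) (row_mx x y) | j in active (g x y)]).

Definition LLICQ (R : realType) n m q
  (g : 'rV[R]_n -> 'rV[R]_m -> 'rV[R]_q)
  (x : 'rV[R]_n) (z : 'rV[R]_m) : Prop :=
  free [seq grad (cpt g j x) z | j in active (g x z)].

Definition LSCC (R : realType) n m q
  (g : 'rV[R]_n -> 'rV[R]_m -> 'rV[R]_q)
  (x : 'rV[R]_n) (z : 'rV[R]_m) (w : 'rV[R]_q) : Prop :=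
  [set j | w 0 j = 0 /\ g x z 0 j = 0] = set0.

Definition nu (R : realType) k (u c : 'rV[R]_k) : set 'I_k :=
  [set i | 0 < u 0 i /\ c 0 i = 0].

Definition d12 (R : realType) n m (d : 'rV[R]_(n + m + m)) : 'rV[R]_(n + m) :=
  lsubmx d.

Definition d13 (R : realType) n m (d : 'rV[R]_(n + m + m)) : 'rV[R]_(n + m) :=
  row_mx (lsubmx (lsubmx d)) (rsubmx d).

Definition Qset (R : realType) n m p q
  (G : 'rV[R]_n -> 'rV[R]_m -> 'rV[R]_p)
  (g : 'rV[R]_n -> 'rV[R]_m -> 'rV[R]_q)
  (x : 'rV[R]_n) (y z : 'rV[R]_m)
  (u : 'rV[R]_p) (v w : 'rV[R]_q) : set 'rV[R]_(n + m + m) :=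
  [set d |
    [/\ forall i, nu u (G x y) i ->
          dotv (grad (uncur (cpt G i)) (row_mx x y)) (d12 d) = 0,
        forall j, nu v (g x y) j ->
          dotv (grad (uncur (cpt g j)) (row_mx x y)) (d12 d) = 0 &
        forall j, nu w (g x z) j ->
          dotv (grad (uncur (cpt g j)) (row_mx x z)) (d13 d) = 0]].

(* Main.v *)
Require Import Defs.
From HB Require Import structures.
From mathcomp Require Import all_boot all_order all_algebra.
From mathcomp Require Import all_classical all_reals all_analysis.
From mathcomp Require Import ring lra.
Set Implicit Arguments.
Unset Strict Implicit.
Unset Printing Implicit Defensive.
Import Order.TTheory GRing.Theory Num.Theory.
Import numFieldNormedType.Exports.
Local Open Scope classical_set_scope.
Local Open Scope ring_scope.

(* Stationarity is a KKT system in s = (x, y, z) with multipliers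
   mu = (u, v, w) for the constraints C = (G(x, y), g(x, y), g(x, z)), in which
   the multipliers of the last block enter the Lagrangian with the negative
   weight - lambda. A limiting Jacobian, hence by convexity every element of
   the Clarke Jacobian, acts on a direction (d, delta) by the differential of
   the gradient of the Lagrangian and, in the row of the k-th constraint, by
   (1 - alpha) D_d C_k - (1 - beta) delta_k with (alpha, beta) in the unit disc
   and sqrt(C_k^2 + mu_k^2) (alpha, beta) = (- C_k, mu_k). If all of this
   vanishes, then d lies in Q and tau_k delta_k D_d C_k >= 0 for every weight
   tau_k; when tau_k < 0 this is where strict complementarity is needed.
   Pairing the gradient rows with d contradicts the second-order condition
   unless d = 0, and then LICQ, first in the z-rows and next in the
   (x, y)-rows, gives delta = 0. *)

Local Notation "''e_' i" := (delta_mx 0 i) (at level 8, i at level 2).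

(** * Directional derivatives and C2 functions on row vectors *)

Section DirectionalDerivatives.
Context {R : realType}.

Lemma derive_comp_linear (V V' W : normedModType R) (L : {linear V -> V'})
  (h : V' -> W) (a v : V) : 'D_v (h \o L) a = 'D_(L v) h (L a).
Proof.
have E : (fun t : R => t^-1 *: (((h \o L) \o shift a) (t *: v) - (h \o L) a)) =
    (fun t : R => t^-1 *: ((h \o shift (L a)) (t *: L v) - h (L a))).
  by apply/funext => t /=; rewrite (linearD L) (linearZZ L).
by rewrite /derive E.
Qed.

Lemma cvg_sum_ord k {T} (F : set_system T) {FF : Filter F}
  (u : 'I_k -> T -> R) (a : 'I_k -> R) : (forall i, u i t @[t --> F] --> a i) ->
  \sum_i u i t @[t --> F] --> \sum_i a i.
Proof. by move=> ua; apply: cvg_big => //; exact: add_continuous. Qed.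

Lemma continuous_sum_ord k (T : topologicalType) (u : 'I_k -> T -> R) x :
  (forall i, {for x, continuous (u i)}) ->
  {for x, continuous (fun t => \sum_i u i t)}.
Proof. by move=> cu; apply: (@cvg_sum_ord k T (nbhs x)) => i; exact: cu. Qed.

(** In finite dimension a linear map is a finite sum of coordinate functions times constant
    vectors. *)
Lemma linear_rV_differentiable k (W : normedModType R)
  (L : {linear 'rV[R]_k -> W}) x : differentiable L x.
Proof.
have -> : (L : _ -> _) =
    \sum_(i < k) (fun s : 'rV[R]_k => s 0 i *: L ('e_i)).
  apply/funext => s; rewrite fct_sumE {1}(row_sum_delta s) linear_sum.
  by apply: eq_bigr => i _; rewrite linearZZ.
apply: differentiable_sum => i.
apply: (@differentiableZl _ _ _ (fun s : 'rV[R]_k => s 0 i)).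
exact: differentiable_coord.
Qed.

Lemma linear_rV_continuous k (W : normedModType R)
  (L : {linear 'rV[R]_k -> W}) : continuous L.
Proof.
by move=> x; apply/differentiable_continuous/linear_rV_differentiable.
Qed.

Lemma derive_coord k l (h : 'rV[R]_k -> 'rV[R]_l) x v j :
  differentiable h x -> ('D_v h x) 0 j = 'D_v (fun s => h s 0 j) x.
Proof. by move=> hx; rewrite derive_mx ?mxE//; apply: diff_derivable. Qed.

Lemma derive_dir_sum (V W : normedModType R) k (a : 'I_k -> R) (e : 'I_k -> V)
  (h : V -> W) x : differentiable h x ->
  'D_(\sum_i a i *: e i) h x = \sum_i a i *: 'D_(e i) h x.
Proof.
move=> hx; rewrite deriveE// linear_sum; apply: eq_bigr => i _.
by rewrite linearZZ deriveE.
Qed.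

Lemma derive_rVE k (h : 'rV[R]_k -> R) x v :
  differentiable h x -> 'D_v h x = \sum_i v 0 i * 'D_('e_i) h x.
Proof. by move=> hx; rewrite {1}(row_sum_delta v) derive_dir_sum. Qed.

Lemma dotvE k (a b : 'rV[R]_k) : dotv a b = \sum_i a 0 i * b 0 i.
Proof. by rewrite /dotv mxE; apply: eq_bigr => i _; rewrite mxE. Qed.

Lemma dotv_grad k (h : 'rV[R]_k -> R) x v :
  differentiable h x -> dotv (grad h x) v = 'D_v h x.
Proof.
move=> hx; rewrite dotvE derive_rVE//; apply: eq_bigr => i _.
by rewrite mxE mulrC.
Qed.

(** Phrased with directional derivatives instead of the gradient and the Hessian: under composition
    with a linear map these only change direction. *)
Definition C2 k (h : 'rV[R]_k -> R) :=
  [/\ forall x, differentiable h x,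
      forall v x, differentiable ('D_v h) x &
      forall v w, continuous ('D_w ('D_v h))].

Lemma derive_gradE k (h : 'rV[R]_k -> R) v :
  (forall x, differentiable h x) ->
  'D_v h = \sum_i (v 0 i \*o (fun x => grad h x 0 i)).
Proof.
move=> dh; apply/funext => x; rewrite fct_sumE derive_rVE//.
by apply: eq_bigr => i _; rewrite /= mxE.
Qed.

Lemma derive2_hess k (h : 'rV[R]_k -> R) v w x :
  (forall x, differentiable h x) -> (forall x, differentiable (grad h) x) ->
  'D_w ('D_v h) x = \sum_i v 0 i * \sum_j w 0 j * hess h x j i.
Proof.
move=> dh dgh; have dgi i : derivable (fun s => grad h s 0 i) x w.
  by apply: (derivable_mxP _ _ _).1; exact: diff_derivable.
rewrite derive_gradE// derive_sum => [|i]; last exact: derivableM.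
apply: eq_bigr => i _; rewrite deriveMl//.
by rewrite -derive_coord// deriveEjacobian// mxE.
Qed.

Lemma twice_cont_diff_C2 k (h : 'rV[R]_k -> R) : twice_cont_diff h -> C2 h.
Proof.
move=> [dh dgh ch]; split => //.
- move=> v x; rewrite derive_gradE//; apply: differentiable_sum => i.
  apply: differentiableM => //.
  apply: (@differentiable_comp _ _ _ _ (grad h) (fun M => M 0 i)) => //.
  exact: differentiable_coord.
- move=> v w x; rewrite (_ : 'D_w ('D_v h) =
    fun x => \sum_i v 0 i * \sum_j w 0 j * hess h x j i); last first.
    by apply/funext => s; exact: derive2_hess.
  apply: continuous_sum_ord => i.
  apply: continuousM; first exact: cst_continuous.
  apply: continuous_sum_ord => j.
  apply: continuousM; first exact: cst_continuous.
  apply: (@continuous_comp _ _ _ (hess h) (fun M => M j i)); first exact: ch.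
  exact: coord_continuous.
Qed.

Lemma C2_grad_differentiable k (h : 'rV[R]_k -> R) x :
  C2 h -> differentiable (grad h) x.
Proof.
move=> [_ dDh _].
have -> : grad h = \sum_(i < k) (fun s => 'D_('e_i) h s *: 'e_i).
  apply/funext => s; rewrite fct_sumE [LHS]row_sum_delta.
  by apply: eq_bigr => i _; rewrite mxE.
by apply: differentiable_sum => i; exact: differentiableZl.
Qed.

Lemma quadf_hess k (h : 'rV[R]_k -> R) d x :
  C2 h -> quadf (hess h x) d = 'D_d ('D_d h) x.
Proof.
move=> h2; have [dh _ _] := h2; rewrite derive2_hess//; last first.
  by move=> s; exact: C2_grad_differentiable.
rewrite /quadf -/(dotv (d *m hess h x) d).
by rewrite dotvE; apply: eq_bigr => i _; rewrite mxE mulrC.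
Qed.

Lemma C2_comp_linear k l (L : {linear 'rV[R]_k -> 'rV[R]_l}) (h : 'rV_l -> R) :
  C2 h -> C2 (h \o L).
Proof.
have DL v (h' : 'rV[R]_l -> R) : 'D_v (h' \o L) = 'D_(L v) h' \o L.
  by apply/funext => x; rewrite derive_comp_linear.
move=> [dh dDh ch]; split.
- move=> x; apply: differentiable_comp => //.
  exact: linear_rV_differentiable.
- move=> v x; rewrite DL; apply: differentiable_comp => //.
  exact: linear_rV_differentiable.
- move=> v w x; rewrite DL DL; apply: continuous_comp; last exact: ch.
  exact: linear_rV_continuous.
Qed.

Lemma derive2_comp_linear k l (L : {linear 'rV[R]_k -> 'rV[R]_l})
  (h : 'rV_l -> R) v w x :
  'D_w ('D_v (h \o L)) x = 'D_(L w) ('D_(L v) h) (L x).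
Proof.
have -> : 'D_v (h \o L) = 'D_(L v) h \o L.
  by apply/funext => s; exact: derive_comp_linear.
by rewrite derive_comp_linear.
Qed.

Lemma deriveD_fun k (h1 h2 : 'rV[R]_k -> R) v :
  (forall x, differentiable h1 x) -> (forall x, differentiable h2 x) ->
  'D_v (h1 + h2) = 'D_v h1 + 'D_v h2.
Proof.
move=> d1 d2; apply/funext => x.
by rewrite deriveD//; exact: diff_derivable.
Qed.

Lemma deriveZ_fun k (h : 'rV[R]_k -> R) c v :
  (forall x, differentiable h x) -> 'D_v (c \*o h) = c \*o 'D_v h.
Proof.
by move=> dh; apply/funext => x; rewrite deriveMl//; exact: diff_derivable.
Qed.

Lemma differentiable_mull k (h : 'rV[R]_k -> R) c x :
  differentiable h x -> differentiable (c \*o h) x.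
Proof. by move=> dh; apply: differentiableM. Qed.

Lemma C2D k (h1 h2 : 'rV[R]_k -> R) : C2 h1 -> C2 h2 -> C2 (h1 + h2).
Proof.
move=> [d1 dD1 c1] [d2 dD2 c2]; split => [x|v x|v w x].
- exact: differentiableD.
- by rewrite (deriveD_fun v d1 d2); exact: differentiableD.
- rewrite (deriveD_fun v d1 d2) (deriveD_fun w (dD1 v) (dD2 v)).
  apply: continuousD; [exact: c1|exact: c2].
Qed.

Lemma C2Z k (h : 'rV[R]_k -> R) c : C2 h -> C2 (c \*o h).
Proof.
move=> [dh dDh ch]; split => [x|v x|v w x].
- exact: differentiable_mull.
- by rewrite (deriveZ_fun c v dh); exact: differentiable_mull.
- rewrite (deriveZ_fun c v dh) (deriveZ_fun c w (dDh v)).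
  apply: continuousM; first exact: cst_continuous.
  exact: ch.
Qed.

Lemma C2_cst k (c : R) : C2 (fun _ : 'rV[R]_k => c).
Proof.
have D0 (a : R) v : 'D_v (fun _ : 'rV[R]_k => a) = (fun _ => 0).
  by apply/funext => x; rewrite derive_cst.
split => [x|v x|v w x].
- exact: differentiable_cst.
- by rewrite D0; exact: differentiable_cst.
- by rewrite (D0 c v) (D0 0 w); exact: cst_continuous.
Qed.

Lemma C2_sum k r (h : 'I_r -> 'rV[R]_k -> R) :
  (forall i, C2 (h i)) -> C2 (\sum_i h i).
Proof.
move=> h2; apply: (big_ind (@C2 k)) => [|h1 h1'|i _].
- exact: C2_cst.
- exact: C2D.
- exact: h2.
Qed.

Lemma derive2D k (h1 h2 : 'rV[R]_k -> R) v w x : C2 h1 -> C2 h2 ->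
  'D_w ('D_v (h1 + h2)) x = 'D_w ('D_v h1) x + 'D_w ('D_v h2) x.
Proof.
move=> [d1 dD1 _] [d2 dD2 _].
by rewrite (deriveD_fun v d1 d2) deriveD//; exact: diff_derivable.
Qed.

Lemma derive2Z k (h : 'rV[R]_k -> R) c v w x : C2 h ->
  'D_w ('D_v (c \*o h)) x = c * 'D_w ('D_v h) x.
Proof.
move=> [dh dDh _].
by rewrite (deriveZ_fun c v dh) deriveMl//; exact: diff_derivable.
Qed.

(** The sum runs over the inner direction, so linearity of the differential in that direction
    carries it through the outer derivative. This is how the gradient rows are later paired with a
    direction. *)
Lemma derive2_dir_sum k (h : 'rV[R]_k -> R) (v w x : 'rV[R]_k) : C2 h ->
  \sum_i v 0 i * 'D_w ('D_('e_i) h) x = 'D_w ('D_v h) x.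
Proof.
move=> [dh dDh _].
have -> : 'D_v h = \sum_i (v 0 i \*o 'D_('e_i) h).
  by apply/funext => s; rewrite fct_sumE derive_rVE.
rewrite derive_sum => [|i].
  apply: eq_bigr => i _; rewrite deriveMl//; exact: diff_derivable.
by apply: diff_derivable; exact: differentiable_mull.
Qed.

End DirectionalDerivatives.

(** * The Fischer-Burmeister function and its multiplier pairs *)

Section FischerBurmeister.
Context {R : realType}.

(** The difference quotient along [v] is the sign of [t]. It equals 1 at [e / 2] and -1 at
    [- (e / 2)], and no limit is at distance less than 1 from both. *)
Lemma norm_not_derivable_along (V : normedModType R) (h : V -> R) a v :
  (forall t : R, h (t *: v + a) = `|t|) -> ~ derivable h a v.
Proof.
move=> ht; rewrite /derivable; set G := (fun _ => _) => /cvg_ex[/= l].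
move=> /cvgrPdist_lt/(_ 1 ltr01);
move=> /nbhs_ballP[e /= e0 He].
have h0 : h a = 0 by have := ht 0; rewrite scale0r add0r normr0.
have GE t : G t = t^-1 * `|t| by rewrite /G /= ht h0 subr0.
have e20 : 0 < e / 2 by rewrite divr_gt0.
have e2e : e / 2 < e by rewrite ltr_pdivrMr// ltr_pMr// ltr1n.
have e2n : e / 2 != 0 by rewrite gt_eqF.
have := He (e / 2); have := He (- (e / 2)).
rewrite -!ball_normE /ball_ /= !sub0r !normrN (gtr0_norm e20) oppr_eq0 !GE.
rewrite normrN invrN (gtr0_norm e20) mulNr mulVf//.
move=> /(_ e2e e2n) h1 /(_ e2e e2n) h2.
by move: h1 h2; rewrite !ltr_norml => /andP[? ?] /andP[? ?]; lra.
Qed.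

(** Away from the origin this says that [(alpha, beta)] is the normalized vector [(a, b)]. The
    division-free form is linear in the pair, hence stable under limits and convex combinations, and
    it is void at the origin. *)
Definition fb_multipliers (a b alpha beta : R) :=
  Num.sqrt (a ^+ 2 + b ^+ 2) * alpha = a /\
  Num.sqrt (a ^+ 2 + b ^+ 2) * beta = b.

(* Differentiating r^2 = a^2 + b^2, where r is differentiable because
   r = phi + a + b, avoids the derivative of the square root. *)
Lemma derive_fischer_burmeister (V : normedModType R) (a b : V -> R) x e :
  differentiable a x -> differentiable b x ->
  differentiable (fun s => fischer_burmeister (a s) (b s)) x ->
  (forall t : R, a (t *: e + x) = a x) ->
  (forall t : R, b (t *: e + x) = b x + t) ->
  exists alpha beta : R,
    [/\ alpha ^+ 2 + beta ^+ 2 = 1, fb_multipliers (a x) (b x) alpha beta &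
      forall v, 'D_v (fun s => fischer_burmeister (a s) (b s)) x =
                (alpha - 1) * 'D_v a x + (beta - 1) * 'D_v b x].
Proof.
set phi := (fun s => fischer_burmeister _ _) => da db dphi ae be.
pose r (s : V) : R := Num.sqrt ((a s) ^+ 2 + (b s) ^+ 2).
have rE : r = phi + a + b.
  apply/funext => s; rewrite /phi /r /fischer_burmeister !fctE; ring.
have dr : differentiable r x.
  by rewrite rE; exact: differentiableD (differentiableD dphi da) db.
have rrE : r * r = a * a + b * b.
  apply/funext => s; rewrite !fctE -!expr2 /r.
  by rewrite sqr_sqrtr// addr_ge0 ?sqr_ge0.
have r2 : r x ^+ 2 = a x ^+ 2 + b x ^+ 2.
  by rewrite /r sqr_sqrtr// addr_ge0 ?sqr_ge0.
(* If [r x] were 0, then [a] and [b] would vanish at [x]. Since [e] freezes [a] and moves [b] at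
   unit speed, [r] would be the absolute value of [t] along [e], which is not derivable. *)
have r0 : r x != 0.
  apply/negP => /eqP r0.
  have : a x ^+ 2 + b x ^+ 2 == 0 by rewrite -r2 r0 expr0n.
  rewrite paddr_eq0 ?sqr_ge0// !sqrf_eq0 => /andP[/eqP a0 /eqP b0].
  apply: (@norm_not_derivable_along _ r x e); last exact: diff_derivable.
  by move=> t; rewrite /r ae be a0 b0 expr0n /= !add0r sqrtr_sqr.
exists (a x / r x), (b x / r x); split.
- by rewrite !expr_div_n -mulrDl -r2 divff// expf_neq0.
- by split; rewrite -/(r x) mulrC divfK.
- move=> v; have pE : phi = r - a - b.
    by rewrite rE; apply/funext => s; rewrite !fctE; ring.
  have Da : derivable a x v by exact: diff_derivable.
  have Db : derivable b x v by exact: diff_derivable.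
  have Dr : derivable r x v by exact: diff_derivable.
  have /(congr1 (fun h => 'D_v h x)) := rrE.
  rewrite (deriveM Dr Dr) (deriveD (derivableM Da Da) (derivableM Db Db)).
  rewrite (deriveM Da Da) (deriveM Db Db) => rr'.
  have -> : 'D_v phi x = 'D_v r x - 'D_v a x - 'D_v b x.
    by rewrite pE (deriveB (derivableB Dr Da) Db) (deriveB Dr Da).
  have : r x * 'D_v r x = a x * 'D_v a x + b x * 'D_v b x.
    by move: rr'; rewrite /GRing.scale /=; lra.
  move=> E; apply: (mulfI r0).
  rewrite !mulrBl !mul1r !mulrBr E mulrDr !mulrBr -!mulrA.
  by field.
Qed.

(** The squared norm of the combination equals the combination of the squared norms minus
    [t * (1 - t)] times the squared distance of the two points. *)
Lemma convex_disc (t a1 b1 a2 b2 : R) : 0 <= t <= 1 ->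
  a1 ^+ 2 + b1 ^+ 2 <= 1 -> a2 ^+ 2 + b2 ^+ 2 <= 1 ->
  (t * a1 + (1 - t) * a2) ^+ 2 + (t * b1 + (1 - t) * b2) ^+ 2 <= 1.
Proof.
move=> /andP[t0 t1] h1 h2; have s0 : 0 <= 1 - t by rewrite subr_ge0.
have := addr_ge0 (sqr_ge0 (a1 - a2)) (sqr_ge0 (b1 - b2)).
move=> /(mulr_ge0 (mulr_ge0 t0 s0)).
have := ler_wpM2l t0 h1; have := ler_wpM2l s0 h2.
by rewrite !expr2; lra.
Qed.

End FischerBurmeister.

(** * Limits of Jacobians along sequences and along ultrafilters *)

Lemma jacobian_entry_cvg (R : realType) k l (H : 'rV[R]_k -> 'rV[R]_l)
  (s : nat -> 'rV[R]_k) A v j :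
  (forall i, differentiable H (s i)) -> ('J H (s i))^T @[i --> \oo] --> A ->
  'D_v (fun x => H x 0 j) (s i) @[i --> \oo] --> (v *m A^T) 0 j.
Proof.
(* A coordinate of [v *m A^T] is a finite linear combination of entries of [A], so convergence of
   the entries suffices. *)
move=> ds JA.
rewrite (_ : (fun i => _) =
  (fun i => \sum_m v 0 m * ('J H (s i))^T j m)); last first.
  apply/funext => i; rewrite -derive_coord// deriveEjacobian// mxE.
  by apply: eq_bigr => m _; rewrite [in RHS]mxE.
rewrite mxE; under [X in _ --> X]eq_bigr do rewrite mxE.
apply: cvg_sum_ord => m; apply: cvgMl_tmp.
apply: (continuous_cvg _ (h := fun M : 'M[R]_(l, k) => M j m) _ JA).
exact: coord_continuous.
Qed.

(** By compactness of the segment the image ultrafilter has a cluster point, and an ultrafilter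
    converges to each of its cluster points. This plays the role of extracting a convergent
    subsequence. *)
Lemma bounded_ultra_cvg (R : realType) (U : set_system nat) (u : nat -> R)
  (c : R) :
  UltraFilter U -> (forall i, `|u i| <= c) -> exists l : R, u @ U --> l.
Proof.
move=> UU uc; have Uc : (u @ U) `[- c, c]%classic.
  suff : U (u @^-1` `[- c, c]%classic) by [].
  by apply: filterE => i; rewrite /= in_itv /= -ler_norml uc.
have [l [_ clu]] := @segment_compact R (- c) c (u @ U) _ Uc.
exists l => B Bl; have [//|UnB] := in_ultra_setVsetC (u @^-1` B) UU.
by have [x [nBx Bx]] := clu (~` B) B UnB Bl.
Qed.

(** * The weighted KKT map and an outer estimate of its Clarke Jacobian *)

Section WeightedKKT.
Context {R : realType} (N K : nat).
Variables (H0 : 'rV[R]_N -> R) (C : 'rV[R]_N -> 'rV[R]_K) (tau : 'rV[R]_K).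

Definition wlag (mu : 'rV[R]_K) (s : 'rV[R]_N) : R :=
  H0 s + \sum_k tau 0 k * mu 0 k * C s 0 k.

(** The weights [tau] enter the gradient block only; the complementarity block pairs the unweighted
    constraints with the multipliers. *)
Definition kkt_map (zeta : 'rV[R]_(N + K)) : 'rV[R]_(N + K) :=
  row_mx (grad (wlag (rsubmx zeta)) (lsubmx zeta))
         (phi_vec (C (lsubmx zeta)) (rsubmx zeta)).

Let con (k : 'I_K) : 'rV[R]_N -> R := fun s => C s 0 k.

Hypotheses (H0_C2 : C2 H0) (C_C2 : forall k, C2 (fun s => C s 0 k)).

Let dH0 x : differentiable H0 x.
Proof. by have [h _ _] := H0_C2; exact: h. Qed.
Let dDH0 v x : differentiable ('D_v H0) x.
Proof. by have [_ h _] := H0_C2; exact: h. Qed.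
Let dcon k x : differentiable (con k) x.
Proof. by have [h _ _] := C_C2 k; exact: h. Qed.
Let dDcon k v x : differentiable ('D_v (con k)) x.
Proof. by have [_ h _] := C_C2 k; exact: h. Qed.
Let dscon mu (k : 'I_K) x : differentiable (tau 0 k * mu \*o con k) x.
Proof. exact: differentiable_mull. Qed.
Let dDscon mu (k : 'I_K) v x :
  differentiable (tau 0 k * mu \*o 'D_v (con k)) x.
Proof. exact: differentiable_mull. Qed.

Lemma wlagE mu : wlag mu = H0 + \sum_k (tau 0 k * mu 0 k \*o con k).
Proof. by apply/funext => s; rewrite /wlag fctE fct_sumE. Qed.

Lemma wlag_C2 mu : C2 (wlag mu).
Proof.
rewrite wlagE; apply: C2D; first exact: H0_C2.
by apply: C2_sum => k; apply: C2Z; exact: C_C2.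
Qed.

Lemma derive_wlag mu v s : 'D_v (wlag mu) s =
  'D_v H0 s + \sum_k tau 0 k * mu 0 k * 'D_v (con k) s.
Proof.
rewrite wlagE deriveD; last 2 first.
- exact/diff_derivable/dH0.
- apply: diff_derivable; apply: differentiable_sum => k; exact: dscon.
rewrite derive_sum => [|k]; last exact/diff_derivable/dscon.
congr (_ + _); apply: eq_bigr => k _.
by rewrite deriveMl//; exact/diff_derivable/dcon.
Qed.

Lemma derive2_wlag mu v w s : 'D_w ('D_v (wlag mu)) s =
  'D_w ('D_v H0) s + \sum_k tau 0 k * mu 0 k * 'D_w ('D_v (con k)) s.
Proof.
have -> : 'D_v (wlag mu) =
    'D_v H0 + \sum_k (tau 0 k * mu 0 k \*o 'D_v (con k)).
  by apply/funext => t; rewrite derive_wlag fctE fct_sumE.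
rewrite deriveD; last 2 first.
- exact/diff_derivable/dDH0.
- apply: diff_derivable; apply: differentiable_sum => k; exact: dDscon.
rewrite derive_sum => [|k]; last exact/diff_derivable/dDscon.
congr (_ + _); apply: eq_bigr => k _.
by rewrite deriveMl//; exact/diff_derivable/dDcon.
Qed.

Let lsub : {linear 'rV[R]_(N + K) -> 'rV[R]_N} := @lsubmx R 1 N K.
Let rsub : {linear 'rV[R]_(N + K) -> 'rV[R]_K} := @rsubmx R 1 N K.

Lemma derive_rsub_coord (zeta v : 'rV[R]_(N + K)) k :
  'D_v (fun s : 'rV[R]_(N + K) => rsubmx s 0 k) zeta = rsubmx v 0 k.
Proof.
rewrite -derive_coord; last exact: differentiable_rsubmx.
rewrite -[rsubmx in LHS]/(id \o rsub) derive_comp_linear.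
by rewrite derive_id.
Qed.

Lemma differentiable_rsub_coord (zeta : 'rV[R]_(N + K)) k :
  differentiable (fun s : 'rV[R]_(N + K) => rsubmx s 0 k) zeta.
Proof.
apply: (@differentiable_comp _ _ _ _ rsub (fun M => M 0 k)).
  exact: differentiable_rsubmx.
exact: differentiable_coord.
Qed.

(** The Lagrangian is affine in the multipliers, so the product rule yields its second derivative at
    frozen multipliers plus one term for each moving multiplier. *)
Lemma derive_kkt_grad (zeta v : 'rV[R]_(N + K)) j :
  'D_v (fun s => kkt_map s 0 (lshift K j)) zeta =
  'D_(lsubmx v) ('D_('e_j) (wlag (rsubmx zeta))) (lsubmx zeta) +
  \sum_k tau 0 k * rsubmx v 0 k * 'D_('e_j) (con k) (lsubmx zeta).
Proof.
pose mu k := fun s : 'rV[R]_(N + K) => rsubmx s 0 k.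
have -> : (fun s => kkt_map s 0 (lshift K j)) = 'D_('e_j) H0 \o lsub +
    \sum_k (tau 0 k \*o (mu k * ('D_('e_j) (con k) \o lsub))).
  apply/funext => s; rewrite /kkt_map row_mxEl mxE derive_wlag !fctE !fct_sumE.
  by congr (_ + _); apply: eq_bigr => k _; rewrite /= !fctE /mu mulrA.
have dc k : differentiable ('D_('e_j) (con k) \o lsub) zeta.
  by apply: differentiable_comp; [exact: differentiable_lsubmx|exact: dDcon].
have dm k : differentiable (mu k * ('D_('e_j) (con k) \o lsub)) zeta.
  by apply: differentiableM; [exact: differentiable_rsub_coord|exact: dc].
have dz k : differentiable
    (tau 0 k \*o (mu k * ('D_('e_j) (con k) \o lsub))) zeta.
  exact: differentiable_mull.
have d0 : differentiable ('D_('e_j) H0 \o lsub) zeta.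
  by apply: differentiable_comp; [exact: differentiable_lsubmx|exact: dDH0].
rewrite (deriveD (diff_derivable d0)
  (diff_derivable (differentiable_sum dz))).
rewrite derive_comp_linear derive2_wlag -addrA; congr (_ + _).
rewrite derive_sum => [|k]; last exact: diff_derivable.
rewrite -big_split /=; apply: eq_bigr => k _.
rewrite (deriveMl _ (diff_derivable (dm k))).
rewrite (deriveM (diff_derivable (differentiable_rsub_coord zeta k))
  (diff_derivable (dc k))).
rewrite derive_comp_linear derive_rsub_coord /GRing.scale /= /mu.
by ring.
Qed.

(** By this continuity all limiting Jacobians at a point share the same gradient rows. *)
Lemma continuous_derive_kkt_grad (v : 'rV[R]_(N + K)) j :
  continuous (fun zeta => 'D_v (fun s => kkt_map s 0 (lshift K j)) zeta).
Proof.
under eq_fun do rewrite derive_kkt_grad derive2_wlag.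
have cl h : continuous h -> continuous (fun z => h (lsub z) : R).
  move=> ch z; apply: (@continuous_comp _ _ _ lsub h); last exact: ch.
  exact: continuous_lsubmx.
have cD (a b : 'rV[R]_(N + K) -> R) z : {for z, continuous a} ->
    {for z, continuous b} -> {for z, continuous (fun t => a t + b t)}.
  by move=> ca cb; exact: (continuousD ca cb).
have [_ _ cH0] := H0_C2.
have ccon k w v' : continuous ('D_w ('D_v' (con k))) by have [_ _] := C_C2 k.
move=> z; apply: (cD _ _ z); first apply: (cD _ _ z).
- exact: (cl _ (cH0 _ _)).
- apply: continuous_sum_ord => k; apply: continuousM; last first.
    exact: (cl _ (ccon _ _ _)).
  apply: continuousM; first exact: cst_continuous.
  exact/differentiable_continuous/differentiable_rsub_coord.
- apply: continuous_sum_ord => k; apply: continuousM.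
    exact: cst_continuous.
  apply: (cl ('D_('e_j) (con k))) => s.
  exact: differentiable_continuous.
Qed.

Lemma derive_kkt_fb (zeta : 'rV[R]_(N + K)) k :
  differentiable kkt_map zeta ->
  exists alpha beta : R, [/\ alpha ^+ 2 + beta ^+ 2 = 1,
    fb_multipliers (- C (lsubmx zeta) 0 k) (rsubmx zeta 0 k) alpha beta &
    forall v, 'D_v (fun s => kkt_map s 0 (rshift N k)) zeta =
      (1 - alpha) * 'D_(lsubmx v) (con k) (lsubmx zeta) +
      (beta - 1) * rsubmx v 0 k].
Proof.
move=> dPhi; pose a := fun s : 'rV[R]_(N + K) => - (con k \o lsub) s.
pose b := fun s : 'rV[R]_(N + K) => rsubmx s 0 k.
have E : (fun s => kkt_map s 0 (rshift N k)) =
    (fun s => fischer_burmeister (a s) (b s)).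
  by apply/funext => s; rewrite /kkt_map row_mxEr mxE.
have dcl : differentiable (con k \o lsub) zeta.
  by apply: differentiable_comp; [exact: differentiable_lsubmx|exact: dcon].
have da : differentiable a zeta by exact: differentiableN.
have db : differentiable b zeta by exact: differentiable_rsub_coord.
have dfb : differentiable (fun s => fischer_burmeister (a s) (b s)) zeta.
  rewrite -E; apply: (@differentiable_comp _ _ _ _ kkt_map
    (fun M => M 0 (rshift N k))) => //.
  exact: differentiable_coord.
(* The direction [row_mx 0 ('e_k)] fixes the constraint value and moves the k-th multiplier at unit
   speed, as [derive_fischer_burmeister] requires. *)
have ae t : a (t *: row_mx 0 ('e_k) + zeta) = a zeta.
  rewrite /a /= (linearD lsub) (linearZZ lsub) /= row_mxKl.
  by rewrite scaler0 add0r.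
have be t : b (t *: row_mx 0 ('e_k) + zeta) = b zeta + t.
  rewrite /b (linearD rsub) (linearZZ rsub) /= row_mxKr.
  by rewrite !mxE !eqxx mulr1 addrC.
have [alpha [beta [ab1 fbm Dfb]]] := derive_fischer_burmeister da db dfb ae be.
exists alpha, beta; split => // v; rewrite E Dfb derive_rsub_coord.
have -> : 'D_v a zeta = - 'D_(lsubmx v) (con k) (lsubmx zeta).
  by rewrite (deriveN (diff_derivable dcl)) derive_comp_linear.
by ring.
Qed.

(** A convex outer description of the Clarke Jacobian through the products [v *m A^T]. The gradient
    rows are fully determined. Each complementarity row has its own multiplier pair, taken in the
    unit disc because the circle is not convex. *)
Definition kkt_jac (s : 'rV[R]_N) (mu : 'rV[R]_K) : set 'M[R]_(N + K) :=
  [set A |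
    (forall v j, (v *m A^T) 0 (lshift K j) =
      'D_(lsubmx v) ('D_('e_j) (wlag mu)) s +
      \sum_k tau 0 k * rsubmx v 0 k * 'D_('e_j) (con k) s) /\
    (forall k, exists alpha beta, [/\ alpha ^+ 2 + beta ^+ 2 <= 1,
      fb_multipliers (- C s 0 k) (mu 0 k) alpha beta &
      forall v, (v *m A^T) 0 (rshift N k) =
        (1 - alpha) * 'D_(lsubmx v) (con k) s + (beta - 1) * rsubmx v 0 k])].

(** The multiplier pairs are combined with the same coefficients as the matrices; the disc is convex
    and the remaining conditions are affine. *)
Lemma kkt_jac_convex s mu : convex_set (kkt_jac s mu).
Proof.
move=> A B t /set_mem[A1 A2] /set_mem[B1 B2]; apply/mem_set.
pose t' : R := t%:inum; have t01 : 0 <= t' <= 1.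
  by rewrite /t'; apply/andP; split.
have vE v j : (v *m (conv t A B)^T) 0 j =
    t' * (v *m A^T) 0 j + (1 - t') * (v *m B^T) 0 j.
  rewrite -[conv t A B]/(t' *: A + (1 - t') *: B) linearD !linearZ /=.
  by rewrite mulmxDr -!scalemxAr !mxE.
split=> [v j|k].
  by rewrite vE A1 B1; ring.
have [a1 [b1 [ab1 [m1 n1] E1]]] := A2 k.
have [a2 [b2 [ab2 [m2 n2] E2]]] := B2 k.
exists (t' * a1 + (1 - t') * a2), (t' * b1 + (1 - t') * b2); split.
- exact: convex_disc.
- split.
    by rewrite mulrDr !(mulrCA _ t') !(mulrCA _ (1 - t')) m1 m2; ring.
  by rewrite mulrDr !(mulrCA _ t') !(mulrCA _ (1 - t')) n1 n2; ring.
- by move=> v; rewrite vE E1 E2; ring.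
Qed.

(** The gradient rows converge by continuity. For a complementarity row, the pairs found at the
    differentiability points are bounded and have a limit along an ultrafilter, to which their
    defining relations pass. *)
Lemma limiting_jacobians_kkt zeta :
  limiting_jacobians kkt_map zeta `<=` kkt_jac (lsubmx zeta) (rsubmx zeta).
Proof.
move=> A [s [ds sz JA]]; split=> [v j|k].
  rewrite -derive_kkt_grad.
  apply: (cvg_unique _ (jacobian_entry_cvg ds JA)).
    exact: norm_hausdorff.
  exact: (continuous_cvg _ (@continuous_derive_kkt_grad v j zeta) sz).
have [al /choice[be Hab]] := choice (fun i => derive_kkt_fb k (ds i)).
(* An ultrafilter finer than [\oo] makes both multiplier sequences converge at once and preserves
   every limit already known. *)
have [U [UU sU]] := @ultraFilterLemma nat \oo _.
have toU (T : topologicalType) (f : nat -> T) (l : T) :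
    f @ \oo --> l -> f @ U --> l.
  exact: cvg_trans (cvg_app f sU).
have bnd (a b : R) : a ^+ 2 + b ^+ 2 = 1 -> `|a| <= 1 /\ `|b| <= 1.
  move=> ab; split; rewrite -(@expr_le1 _ 2)// real_normK ?num_real// -ab.
    by rewrite lerDl sqr_ge0.
  by rewrite lerDr sqr_ge0.
have [a0 ala] : exists l : R, al @ U --> l.
  by apply: (bounded_ultra_cvg (c := 1)) => // i; have [/bnd[]] := Hab i.
have [b0 beb] : exists l : R, be @ U --> l.
  by apply: (bounded_ultra_cvg (c := 1)) => // i; have [/bnd[]] := Hab i.
have uniq (u u' : nat -> R) (l l' : R) : u @ U --> l -> u' @ U --> l' ->
    (forall i, u i = u' i) -> l = l'.
  move=> ul ul' uu'; have E : u = u' by apply/funext.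
  move: ul'; rewrite -E => ul';
  apply: (cvg_unique _ ul ul').
  exact: norm_hausdorff.
have szU : s @ U --> zeta by exact: (toU _ _ _ sz).
have ccon : {for zeta, continuous (con k \o lsub)}.
  apply: differentiable_continuous.
  by apply: differentiable_comp; [exact: differentiable_lsubmx|exact: dcon].
have cC : - C (lsubmx (s i)) 0 k @[i --> U] --> - C (lsubmx zeta) 0 k.
  by apply: cvgN; exact: (continuous_cvg _ ccon szU).
have cmu : rsubmx (s i) 0 k @[i --> U] --> rsubmx zeta 0 k.
  apply: (continuous_cvg _ (h := fun x : 'rV[R]_(N + K) => rsubmx x 0 k) _ szU).
  exact/differentiable_continuous/differentiable_rsub_coord.
have cr : Num.sqrt ((- C (lsubmx (s i)) 0 k) ^+ 2 + (rsubmx (s i) 0 k) ^+ 2)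
    @[i --> U] -->
    Num.sqrt ((- C (lsubmx zeta) 0 k) ^+ 2 + (rsubmx zeta 0 k) ^+ 2).
  apply: continuous_cvg; first exact: sqrt_continuous.
  by apply: cvgD; rewrite expr2; under eq_fun do rewrite expr2; exact: cvgM.
exists a0, b0; split.
(* The equation of the circle itself passes to the limit and gives the bound of the disc. *)
- rewrite le_eqVlt; apply/orP; left; apply/eqP.
  apply: (uniq (fun i => al i * al i + be i * be i) (fun=> 1)).
  + by rewrite !expr2; apply: cvgD; exact: cvgM.
  + exact: cvg_cst.
  + by move=> i; have [<- _ _] := Hab i; rewrite !expr2.
- split.
    apply: uniq (cvgM cr ala) cC _ => i.
    by have [_ [+ _] _] := Hab i.
  apply: uniq (cvgM cr beb) cmu _ => i.
  by have [_ [_ +] _] := Hab i.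
- move=> v; apply: uniq (toU _ _ _ (jacobian_entry_cvg ds JA)) _ _; last first.
    by move=> i; have [_ _ ->] := Hab i.
  apply: cvgD; apply: cvgM.
  + by apply: cvgB => //; exact: cvg_cst.
  + apply: (continuous_cvg _ (h := 'D_(lsubmx v) (con k) \o lsub) _ szU).
    apply: differentiable_continuous.
    by apply: differentiable_comp; [exact: differentiable_lsubmx|exact: dDcon].
  + by apply: cvgB => //; exact: cvg_cst.
  + exact: cvg_cst.
Qed.

Lemma clarke_jacobian_kkt zeta :
  clarke_jacobian kkt_map zeta `<=` kkt_jac (lsubmx zeta) (rsubmx zeta).
Proof.
apply: smallest_sub; first exact: kkt_jac_convex.
exact: limiting_jacobians_kkt.
Qed.

End WeightedKKT.

(** * Sign information in the complementarity rows and nonsingularity *)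

Lemma fb_multipliers_active (R : realType) (mu alpha beta : R) : 0 < mu ->
  fb_multipliers 0 mu alpha beta -> alpha = 0 /\ beta = 1.
Proof.
rewrite /fb_multipliers expr0n add0r sqrtr_sqr => mu0.
rewrite gtr0_norm// => -[a b]; have muN0 : mu != 0 by rewrite gt_eqF.
by split; apply: (mulfI muN0); rewrite ?a ?b ?mulr0 ?mulr1.
Qed.

Lemma fb_multipliers_inactive (R : realType) (c alpha beta : R) : 0 < c ->
  fb_multipliers c 0 alpha beta -> alpha = 1 /\ beta = 0.
Proof.
rewrite /fb_multipliers expr0n addr0 sqrtr_sqr => c0.
rewrite gtr0_norm// => -[a b]; have cN0 : c != 0 by rewrite gt_eqF.
by split; apply: (mulfI cN0); rewrite ?a ?b ?mulr0 ?mulr1.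
Qed.

(** The row reads [(1 - alpha) * x = (1 - beta) * y] with both factors nonnegative, so [x] and [y]
    do not have opposite signs when [alpha < 1]. On the disc [alpha = 1] forces [beta = 0], and then
    [y = 0]. *)
Lemma disc_row_ge0 (R : realType) (alpha beta x y : R) :
  alpha ^+ 2 + beta ^+ 2 <= 1 -> (1 - alpha) * x + (beta - 1) * y = 0 ->
  0 <= y * x.
Proof.
move=> ab E; have a1 : alpha <= 1.
  by rewrite leNgt; apply/negP => ?; move: ab; rewrite !expr2; nra.
have b1 : beta <= 1.
  by rewrite leNgt; apply/negP => ?; move: ab; rewrite !expr2; nra.
have [aE|aN] := eqVneq alpha 1.
  have b0 : beta = 0.
    apply/eqP; rewrite -sqrf_eq0 eq_le sqr_ge0 andbT.
    by move: ab; rewrite aE expr1n; lra.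
  have -> : y = 0 by move: E; rewrite aE b0; lra.
  by rewrite mul0r.
have a0 : 0 < 1 - alpha by rewrite subr_gt0 lt_neqAle aN.
rewrite -(pmulr_rge0 _ a0).
have -> : (1 - alpha) * (y * x) = (1 - beta) * y ^+ 2.
  have -> : (1 - alpha) * (y * x) = y * ((1 - alpha) * x) by ring.
  have -> : (1 - alpha) * x = (1 - beta) * y by lra.
  by ring.
by rewrite mulr_ge0 ?sqr_ge0// subr_ge0.
Qed.

Section KKTRegularity.
Context {R : realType} (N K : nat).
Variables (H0 : 'rV[R]_N -> R) (C : 'rV[R]_N -> 'rV[R]_K) (tau : 'rV[R]_K).
Hypotheses (H0_C2 : C2 H0) (C_C2 : forall k, C2 (fun s => C s 0 k)).
Variables (s : 'rV[R]_N) (mu : 'rV[R]_K).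
Hypotheses (mu_ge0 : forall k, 0 <= mu 0 k) (C_le0 : forall k, C s 0 k <= 0).
Hypothesis slack : forall k, mu 0 k * C s 0 k = 0.
Hypothesis strict : forall k, tau 0 k < 0 -> ~ (mu 0 k = 0 /\ C s 0 k = 0).
Hypothesis sosc : forall d,
  (forall k, 0 < mu 0 k -> 'D_d (fun x => C x 0 k) s = 0) -> d <> 0 ->
  0 < 'D_d ('D_d (wlag H0 C tau mu)) s.
Hypothesis licq : forall delta : 'rV[R]_K,
  (forall k, C s 0 k < 0 -> delta 0 k = 0) ->
  \sum_k (tau 0 k * delta 0 k) *: grad (fun x => C x 0 k) s = 0 -> delta = 0.

Let con (k : 'I_K) : 'rV[R]_N -> R := fun s => C s 0 k.

(** Here [x] stands for the derivative of the k-th constraint along [d] and [y] for the k-th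
    multiplier direction. The cases are a positive multiplier, an inactive constraint, and both
    quantities zero. *)
Lemma kkt_row k (x y alpha beta : R) : alpha ^+ 2 + beta ^+ 2 <= 1 ->
  fb_multipliers (- C s 0 k) (mu 0 k) alpha beta ->
  (1 - alpha) * x + (beta - 1) * y = 0 ->
  [/\ 0 < mu 0 k -> x = 0, C s 0 k < 0 -> y = 0 & 0 <= tau 0 k * y * x].
Proof.
move=> ab fbm E.
have [mu0|mu0] := boolP (0 < mu 0 k).
  have C0 : C s 0 k = 0.
    apply/eqP; move/eqP: (slack k); rewrite mulf_eq0 => /orP[|//].
    by rewrite gt_eqF.
  move: fbm; rewrite C0 oppr0 => /(fb_multipliers_active mu0)[aE bE].
  have x0 : x = 0 by move: E; rewrite aE bE; lra.
  by split=> //; rewrite ?ltxx// x0 mulr0.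
have {mu0} muk : mu 0 k = 0.
  by apply/eqP; rewrite eq_le mu_ge0 andbT leNgt.
have [C0|C0] := boolP (C s 0 k < 0).
  move: fbm; rewrite muk => /fb_multipliers_inactive[|aE bE].
    by rewrite oppr_gt0.
  have y0 : y = 0 by move: E; rewrite aE bE; lra.
  by split=> //; rewrite ?ltxx// y0 mulr0 mul0r.
have {C0} Ck : C s 0 k = 0.
  by apply/eqP; rewrite eq_le C_le0 leNgt.
(* At a biactive index [fb_multipliers] carries no information: the sign of [y * x] comes from the
   disc, and [strict] excludes a negative weight. *)
split=> //.
rewrite -mulrA mulr_ge0//; last exact: disc_row_ge0 ab E.
by rewrite leNgt; apply/negP => /strict; apply.
Qed.

Lemma kkt_jac_unitmx A : kkt_jac H0 C tau s mu A -> A \in unitmx.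
Proof.
(* As [kkt_jac] controls the products [v *m A^T], invertibility is shown for [A^T], by proving that
   each [v] in its left kernel vanishes. *)
move=> [At Ab]; rewrite -unitmx_tr -row_free_unit -kermx_eq0.
apply/rowV0P => v /sub_kermxP vA.
pose d := lsubmx v; pose delta := rsubmx v.
have row k : [/\ 0 < mu 0 k -> 'D_d (con k) s = 0,
    C s 0 k < 0 -> delta 0 k = 0 &
    0 <= tau 0 k * delta 0 k * 'D_d (con k) s].
  have [al [be [ab fbm E]]] := Ab k.
  by apply: (kkt_row ab fbm); rewrite -E vA mxE.
have grad0 j : 'D_d ('D_('e_j) (wlag H0 C tau mu)) s +
    \sum_k tau 0 k * delta 0 k * 'D_('e_j) (con k) s = 0.
  by rewrite -At vA mxE.
have dcon k x : differentiable (con k) x.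
  by have [h _ _] := C_C2 k; exact: h.
(* Multiply the j-th gradient row by [d 0 j] and sum over [j]; exchanging the sums assembles the
   derivatives of the constraints along [d]. *)
have quad0 : 'D_d ('D_d (wlag H0 C tau mu)) s +
    \sum_k tau 0 k * delta 0 k * 'D_d (con k) s = 0.
  rewrite -(derive2_dir_sum d d s (wlag_C2 tau H0_C2 C_C2 mu)).
  under [X in _ + X]eq_bigr do rewrite (derive_rVE _ (dcon _ _)) mulr_sumr.
  rewrite exchange_big -big_split big1//= => j _.
  have /(congr1 (GRing.mul (d 0 j))) := grad0 j.
  rewrite mulr0 mulrDr mulr_sumr; apply: etrans; congr (_ + _).
  by apply: eq_bigr => k _; rewrite mulrCA.
(* By [quad0] the second-order term is minus a sum of nonnegative terms, against [sosc] for nonzero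
   [d]. *)
have d0 : d = 0.
  apply: contrapT => dN0; have : 0 < 'D_d ('D_d (wlag H0 C tau mu)) s.
    by apply: sosc => // k; have [h _ _] := row k; exact: h.
  apply/negP; rewrite -leNgt (_ : 'D_d _ s =
    - \sum_k tau 0 k * delta 0 k * 'D_d (con k) s); last first.
    by apply/eqP; rewrite -addr_eq0 quad0.
  by rewrite oppr_le0 sumr_ge0// => k _; have [] := row k.
(* For [d = 0] the gradient rows reduce to a vanishing weighted combination of constraint
   gradients. *)
have delta0 : delta = 0.
  apply: licq => [k|]; first by have [_ h _] := row k; exact: h.
  apply/rowP => j; rewrite summxE [RHS]mxE.
  apply: etrans (grad0 j); rewrite d0 derive0 add0r.
  by apply: eq_bigr => k _; rewrite !mxE.
by rewrite -[v]hsubmxK -/d -/delta d0 delta0 row_mx0.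
Qed.

Lemma kkt_map_CD_regular : CD_regular (kkt_map H0 C tau) (row_mx s mu).
Proof.
move=> W /(clarke_jacobian_kkt H0_C2 C_C2).
by rewrite row_mxKl row_mxKr; exact: kkt_jac_unitmx.
Qed.

End KKTRegularity.

(** * Linear independence of indexed families, and vectors in three blocks *)

Lemma free_image_coef (F : fieldType) (V : vectType F) (I : finType)
  (P : pred I) (X : I -> V) (a : I -> F) :
  free [seq X j | j in P] -> (forall j, ~~ P j -> a j = 0) ->
  \sum_j a j *: X j = 0 -> forall j, a j = 0.
Proof.
move=> freeX aP sum0 j; have [Pj|/aP//] := boolP (P j).
have /freeP/(_ (a \o enum_val)) : free (image_tuple X P) by [].
(* Coefficients vanish off [P], so the full sum is the sum over the enumeration of [P]. *)
have <- : \sum_j a j *: X j =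
    \sum_(i < #|P|) (a \o enum_val) i *: (image_tuple X P)`_i.
  rewrite (bigID P) /= [X in _ + X]big1 ?addr0 => [|i /aP->]; last first.
    by rewrite scale0r.
  rewrite (big_enum_val (A := P)) /=; apply: eq_bigr => i _.
  by rewrite nth_image.
by move=> /(_ sum0 (enum_rank_in Pj j)); rewrite /= enum_rankK_in.
Qed.

Lemma sum_in_span (F : fieldType) (V : vectType F) (I : finType)
  (P : pred I) (X : I -> V) (a : I -> F) :
  (forall j, ~~ P j -> a j = 0) ->
  \sum_j a j *: X j \in <<[seq X j | j in P]>>%VS.
Proof.
move=> aP; apply: rpred_sum => j _; have [Pj|/aP->] := boolP (P j).
  by rewrite rpredZ// memv_span// fintype.image_f.
by rewrite scale0r rpred0.
Qed.

(** The first sum is the opposite of the second, hence lies in both spans, which meet only in 0;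
    each family is then treated alone. *)
Lemma free_cat_image_coef (F : fieldType) (V : vectType F) (I J : finType)
  (P : pred I) (Q : pred J) (X : I -> V) (Y : J -> V)
  (a : I -> F) (b : J -> F) :
  free ([seq X i | i in P] ++ [seq Y j | j in Q]) ->
  (forall i, ~~ P i -> a i = 0) -> (forall j, ~~ Q j -> b j = 0) ->
  \sum_i a i *: X i + \sum_j b j *: Y j = 0 ->
  (forall i, a i = 0) /\ (forall j, b j = 0).
Proof.
rewrite cat_free => /and3P[fX fY /directv_addP dXY] aP bQ sum0.
have X0 : \sum_i a i *: X i = 0.
  apply/eqP; rewrite -memv0 -dXY memv_cap sum_in_span//=.
  by rewrite -rpredN (addr0_eq sum0) sum_in_span.
split; first exact: (free_image_coef fX aP X0).
by apply: (free_image_coef fY bQ); move: sum0; rewrite X0 add0r.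
Qed.

(** All products have the same sign and their sum is zero. *)
Lemma complementary_slack (R : realType) k (u c : 'rV[R]_k) i :
  complementary u c -> u 0 i * c 0 i = 0.
Proof.
move=> [u0 c0]; rewrite dotvE => uc.
apply/eqP; rewrite -oppr_eq0; apply/eqP.
apply: (psumr_eq0P (P := xpredT) (F := fun i => - (u 0 i * c 0 i))) => //.
  by move=> j _; rewrite oppr_ge0 mulr_ge0_le0.
by rewrite sumrN uc oppr0.
Qed.

Lemma sum_ord3 (V : nmodType) p q r (h : 'I_(p + q + r) -> V) :
  \sum_k h k = \sum_i h (lshift r (lshift q i)) +
    \sum_j h (lshift r (rshift p j)) + \sum_j h (rshift (p + q) j).
Proof. by rewrite !big_split_ord. Qed.

Lemma ord3_ind p q r (P : 'I_(p + q + r) -> Prop) :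
  (forall i, P (lshift r (lshift q i))) ->
  (forall j, P (lshift r (rshift p j))) ->
  (forall j, P (rshift (p + q) j)) -> forall k, P k.
Proof.
move=> P1 P2 P3 k; case: (split_ordP k) => [k' ->|j ->//].
by case: (split_ordP k') => i ->.
Qed.

Lemma phi_vec_row_mx (R : realType) k l (c u : 'rV[R]_k) (c' u' : 'rV[R]_l) :
  phi_vec (row_mx c c') (row_mx u u') = row_mx (phi_vec c u) (phi_vec c' u').
Proof.
apply/rowP => i; rewrite mxE; case: (split_ordP i) => j ->.
  by rewrite !row_mxEl mxE.
by rewrite !row_mxEr mxE.
Qed.

(** Links the partial gradients in [LLICQ] with derivatives of the uncurried constraints. *)
Lemma derive_uncur_r (R : realType) n m (h : 'rV[R]_n -> 'rV[R]_m -> R) x z e :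
  'D_(row_mx 0 e) (uncur h) (row_mx x z) = 'D_e (h x) z.
Proof.
rewrite /derive.
rewrite (_ : (fun t : R => _) =
  (fun t : R => t^-1 *: ((h x \o shift z) (t *: e) - h x z)))//.
apply/funext => t; rewrite /uncur /= scale_row_mx add_row_mx.
by rewrite !row_mxKl !row_mxKr scaler0 add0r.
Qed.

Fact d13_is_linear (R : realType) n m : linear (@d13 R n m).
Proof.
move=> a s t; rewrite /d13 scale_row_mx add_row_mx.
by congr row_mx; rewrite !linearP.
Qed.
HB.instance Definition _ (R : realType) n m :=
  GRing.isLinear.Build R _ _ _ (@d13 R n m) (@d13_is_linear R n m).

(** * The bilevel stationarity system as a weighted KKT system *)

Section Bilevel.
Context (R : realType) (n m p q : nat).
Variables (F f : 'rV[R]_n -> 'rV[R]_m -> R).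
Variables (G : 'rV[R]_n -> 'rV[R]_m -> 'rV[R]_p).
Variables (g : 'rV[R]_n -> 'rV[R]_m -> 'rV[R]_q) (lambda : R).

Let L12 : {linear 'rV[R]_(n + m + m) -> 'rV[R]_(n + m)} := @lsubmx R 1 _ _.
Let L13 : {linear 'rV[R]_(n + m + m) -> 'rV[R]_(n + m)} := @d13 R n m.

(** The part of [Lag] free of multipliers. *)
Definition objective : 'rV[R]_(n + m + m) -> R :=
  (uncur F \o L12) + (lambda \*o (uncur f \o L12)) +
  (- lambda \*o (uncur f \o L13)).

Definition constraints (s : 'rV[R]_(n + m + m)) : 'rV[R]_(p + q + q) :=
  row_mx (row_mx (uncur G (L12 s)) (uncur g (L12 s))) (uncur g (L13 s)).

(* The follower's constraints enter the Lagrangian through [- lambda * ell]. *)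
Definition weights : 'rV[R]_(p + q + q) :=
  row_mx (row_mx (const_mx 1) (const_mx 1)) (const_mx (- lambda)).

Lemma weights_G i : weights 0 (lshift q (lshift q i)) = 1.
Proof. by rewrite !row_mxEl mxE. Qed.

Lemma weights_g_y j : weights 0 (lshift q (rshift p j)) = 1.
Proof. by rewrite row_mxEl row_mxEr mxE. Qed.

Lemma weights_g_z j : weights 0 (rshift (p + q) j) = - lambda.
Proof. by rewrite row_mxEr mxE. Qed.

Lemma constraints_G i : (fun s => constraints s 0 (lshift q (lshift q i))) =
  uncur (cpt G i) \o L12.
Proof. by apply/funext => s; rewrite !row_mxEl. Qed.

Lemma constraints_g_y j : (fun s => constraints s 0 (lshift q (rshift p j))) =
  uncur (cpt g j) \o L12.
Proof. by apply/funext => s; rewrite row_mxEl row_mxEr. Qed.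

Lemma constraints_g_z j : (fun s => constraints s 0 (rshift (p + q) j)) =
  uncur (cpt g j) \o L13.
Proof. by apply/funext => s; rewrite row_mxEr. Qed.

Lemma wlag_Lag u v w :
  wlag objective constraints weights (row_mx (row_mx u v) w) =
  uncur (uncur (fun x y z => Lag F f G g lambda x y z u v w)).
Proof.
apply/funext => s; rewrite /wlag sum_ord3 /objective !fctE.
rewrite /uncur /Lag /calL /ell !dotvE /=.
rewrite /constraints /weights.
under eq_bigr do rewrite !row_mxEl mxE mul1r.
under [X in _ + (_ + X + _)]eq_bigr do
  rewrite !row_mxEl !row_mxEr mxE mul1r.
under [X in _ + (_ + _ + X)]eq_bigr do rewrite !row_mxEr mxE -mulrA.
rewrite -mulr_sumr /uncur /d13 !row_mxKl !row_mxKr.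
by ring.
Qed.

(** The gradient blocks agree by [wlag_Lag]; the three complementarity blocks concatenate because
    [phi_vec] acts coordinatewise. *)
Lemma Phi_kkt_map :
  Phi F f G g lambda = kkt_map objective constraints weights.
Proof.
apply/funext => zeta; rewrite /Phi /kkt_map.
congr row_mx.
  rewrite /grad_xyz_Lag -wlag_Lag !hsubmxK //.
have E : rsubmx zeta = row_mx (row_mx (lsubmx (lsubmx (rsubmx zeta)))
  (rsubmx (lsubmx (rsubmx zeta)))) (rsubmx (rsubmx zeta)).
  by rewrite !hsubmxK.
rewrite [X in _ = phi_vec _ X]E !phi_vec_row_mx.
by rewrite /uncur /= /d13 !row_mxKl !row_mxKr.
Qed.

Hypotheses (F_C2 : C2 (uncur F)) (f_C2 : C2 (uncur f)).
Hypotheses (G_C2 : forall i, C2 (uncur (cpt G i))).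
Hypotheses (g_C2 : forall j, C2 (uncur (cpt g j))).

Lemma objective_C2 : C2 objective.
Proof.
apply: C2D; first apply: C2D.
- exact: C2_comp_linear.
- by apply: C2Z; exact: C2_comp_linear.
- by apply: C2Z; exact: C2_comp_linear.
Qed.

Lemma constraints_C2 k : C2 (fun s => constraints s 0 k).
Proof.
elim/ord3_ind: k => k.
- by have := C2_comp_linear L12 (G_C2 k); rewrite -constraints_G.
- by have := C2_comp_linear L12 (g_C2 k); rewrite -constraints_g_y.
- by have := C2_comp_linear L13 (g_C2 k); rewrite -constraints_g_z.
Qed.

Lemma calL_C2 u v :
  C2 (uncur (fun x y => calL F f G g lambda x y u v)).
Proof.
have -> : uncur (fun x y => calL F f G g lambda x y u v) =
    uncur F + \sum_i (u 0 i \*o uncur (cpt G i)) +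
    \sum_j (v 0 j \*o uncur (cpt g j)) + (lambda \*o uncur f).
  by apply/funext => s; rewrite !fctE !fct_sumE /uncur /calL !dotvE.
exact: (C2D (C2D (C2D F_C2 (C2_sum (fun i => C2Z (u 0 i) (G_C2 i))))
  (C2_sum (fun j => C2Z (v 0 j) (g_C2 j)))) (C2Z lambda f_C2)).
Qed.

Lemma ell_C2 w : C2 (uncur (fun x z => ell f g x z w)).
Proof.
have -> : uncur (fun x z => ell f g x z w) =
    uncur f + \sum_j (w 0 j \*o uncur (cpt g j)).
  by apply/funext => s; rewrite !fctE !fct_sumE /uncur /ell !dotvE.
exact: (C2D f_C2 (C2_sum (fun j => C2Z (w 0 j) (g_C2 j)))).
Qed.

(** Composition with a linear map is differentiated along the image of the direction, and [L12],
    [L13] send [d] to [d12 d], [d13 d]. *)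
Lemma derive2_wlag_split (h h' : 'rV[R]_(n + m) -> R) d x y z :
  C2 h -> C2 h' ->
  'D_d ('D_d ((h \o L12) + (- lambda \*o (h' \o L13))))
    (row_mx (row_mx x y) z) =
  quadf (hess h (row_mx x y)) (d12 d) -
  lambda * quadf (hess h' (row_mx x z)) (d13 d).
Proof.
move=> h2 h2'.
apply: etrans (congr2 (fun a b => a - lambda * b)
  (esym (quadf_hess (d12 d) (row_mx x y) h2))
  (esym (quadf_hess (d13 d) (row_mx x z) h2'))).
have hL := C2_comp_linear L12 h2; have hL' := C2_comp_linear L13 h2'.
rewrite (derive2D _ _ _ hL (C2Z _ hL')) (derive2Z _ _ _ _ hL').
rewrite (derive2_comp_linear L12) (derive2_comp_linear L13).
rewrite mulNr /= row_mxKl.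
by rewrite [d13 (row_mx _ _)]/d13 !row_mxKl row_mxKr.
Qed.

Lemma derive2_wlag_bilevel u v w d x y z :
  'D_d ('D_d (wlag objective constraints weights (row_mx (row_mx u v) w)))
    (row_mx (row_mx x y) z) =
  quadf (hess (uncur (fun x' y' => calL F f G g lambda x' y' u v))
           (row_mx x y)) (d12 d) -
  lambda * quadf (hess (uncur (fun x' z' => ell f g x' z' w))
           (row_mx x z)) (d13 d).
Proof.
have -> : wlag objective constraints weights (row_mx (row_mx u v) w) =
    (uncur (fun x' y' => calL F f G g lambda x' y' u v) \o L12) +
    (- lambda \*o (uncur (fun x' z' => ell f g x' z' w) \o L13)).
  rewrite wlag_Lag; apply/funext => s.
  by rewrite !fctE /uncur /Lag /= /d13 row_mxKl row_mxKr mulNr.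
exact: derive2_wlag_split (calL_C2 u v) (ell_C2 w).
Qed.

Lemma derive_constraints e x y z k :
  'D_e (fun s => constraints s 0 k) (row_mx (row_mx x y) z) =
  row_mx (row_mx (\row_i 'D_(L12 e) (uncur (cpt G i)) (row_mx x y))
                 (\row_j 'D_(L12 e) (uncur (cpt g j)) (row_mx x y)))
         (\row_j 'D_(L13 e) (uncur (cpt g j)) (row_mx x z)) 0 k.
Proof.
have L13E : L13 (row_mx (row_mx x y) z) = row_mx x z.
  by rewrite /= /d13 !row_mxKl row_mxKr.
elim/ord3_ind: k => k.
- apply: etrans (congr1 (fun h => 'D_e h _) (constraints_G k)) _.
  by rewrite derive_comp_linear /= row_mxKl !row_mxEl mxE.
- apply: etrans (congr1 (fun h => 'D_e h _) (constraints_g_y k)) _.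
  by rewrite derive_comp_linear /= row_mxKl row_mxEl row_mxEr mxE.
- apply: etrans (congr1 (fun h => 'D_e h _) (constraints_g_z k)) _.
  by rewrite derive_comp_linear L13E row_mxEr mxE.
Qed.

(** Pairing the vanishing combination with a direction [e] separates the three blocks, so that a
    suitable [e] can isolate some of them. *)
Lemma derive_weighted_constraints (delta : 'rV[R]_(p + q + q)) e x y z :
  \sum_k (weights 0 k * delta 0 k) *:
    grad (fun s => constraints s 0 k) (row_mx (row_mx x y) z) = 0 ->
  \sum_i delta 0 (lshift q (lshift q i)) *
      'D_(L12 e) (uncur (cpt G i)) (row_mx x y) +
    \sum_j delta 0 (lshift q (rshift p j)) *
      'D_(L12 e) (uncur (cpt g j)) (row_mx x y) -
    lambda * \sum_j delta 0 (rshift (p + q) j) *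
      'D_(L13 e) (uncur (cpt g j)) (row_mx x z) = 0.
Proof.
move=> grad0; pose s := row_mx (row_mx x y) z.
have : \sum_k weights 0 k * delta 0 k * 'D_e (fun s => constraints s 0 k) s = 0.
  have : dotv (\sum_k (weights 0 k * delta 0 k) *:
    grad (fun s => constraints s 0 k) s) e = 0.
    by rewrite grad0 /dotv mul0mx mxE.
  rewrite /dotv mulmx_suml summxE; apply: etrans; apply: eq_bigr => k _.
  rewrite -scalemxAl [RHS]mxE; congr (_ * _); apply: esym.
  by apply: dotv_grad; have [h _ _] := constraints_C2 k; exact: h.
under eq_bigr do rewrite derive_constraints.
rewrite sum_ord3; apply: etrans; congr (_ + _ + _).
- by apply: eq_bigr => i _; rewrite weights_G mul1r !row_mxEl mxE.
- by apply: eq_bigr => j _; rewrite weights_g_y mul1r row_mxEl row_mxEr mxE.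
- rewrite -mulNr mulr_sumr; apply: eq_bigr => j _.
  by rewrite weights_g_z row_mxEr mxE mulrA.
Qed.

Lemma bilevel_licq x y z (delta : 'rV[R]_(p + q + q)) : 0 < lambda ->
  ULICQ G g x y -> LLICQ g x z ->
  (forall k, constraints (row_mx (row_mx x y) z) 0 k <= 0) ->
  (forall k, constraints (row_mx (row_mx x y) z) 0 k < 0 -> delta 0 k = 0) ->
  \sum_k (weights 0 k * delta 0 k) *:
    grad (fun s => constraints s 0 k) (row_mx (row_mx x y) z) = 0 ->
  delta = 0.
Proof.
move=> lambda0 ulicq llicq cle0 inact grad0.
have conE : constraints (row_mx (row_mx x y) z) =
    row_mx (row_mx (G x y) (g x y)) (g x z).
  by rewrite /constraints /uncur /= /d13 !row_mxKl !row_mxKr.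
have delta0 k : row_mx (row_mx (G x y) (g x y)) (g x z) 0 k != 0 ->
    delta 0 k = 0.
  by rewrite -conE => cN0; apply: inact; rewrite lt_neqAle cN0 cle0.
have D0 k (h : 'rV[R]_k -> R) s : 'D_0 h s = 0 by exact: derive0.
(* The directions [row_mx 0 ('e_i)] move [z] alone and are seen only by the third block; its factor
   [lambda] is nonzero, so [LLICQ] applies. *)
have w0 j : delta 0 (rshift (p + q) j) = 0.
  apply: (free_image_coef (a := fun j => delta 0 (rshift (p + q) j)) llicq).
    by move=> i iN; apply: delta0; rewrite row_mxEr.
  apply/rowP => i; rewrite summxE mxE.
  have := derive_weighted_constraints (row_mx 0 ('e_i)) grad0.
  rewrite /= row_mxKl [d13 _]/d13 row_mxKl row_mxKr linear0.
  rewrite [X in X + _ - _]big1 => [|k _]; last by rewrite D0 mulr0.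
  rewrite [X in _ + X - _]big1 => [|k _]; last by rewrite D0 mulr0.
  rewrite !add0r.
  move/eqP; rewrite oppr_eq0 mulf_eq0 gt_eqF//= => /eqP; apply: etrans.
  by apply: eq_bigr => k _; rewrite !mxE derive_uncur_r.
(* With the third block of [delta] gone, the directions that fix [z] leave the relation to which
   [ULICQ] applies. *)
have sum0 : \sum_i delta 0 (lshift q (lshift q i)) *:
      grad (uncur (cpt G i)) (row_mx x y) +
    \sum_j delta 0 (lshift q (rshift p j)) *:
      grad (uncur (cpt g j)) (row_mx x y) = 0.
  apply/rowP => i; rewrite mxE !summxE [RHS]mxE.
  apply: etrans (derive_weighted_constraints (row_mx ('e_i) 0) grad0).
  rewrite /= row_mxKl [X in _ - _ * X]big1 ?mulr0 ?subr0 => [|k _].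
    by congr (_ + _); apply: eq_bigr => k _; rewrite !mxE.
  by rewrite w0 mul0r.
(* The two function arguments transport inactivity in [G x y] or [g x y] to the concatenated vector
   used by [delta0]. *)
have [u0 v0] := free_cat_image_coef
  (a := fun i => delta 0 (lshift q (lshift q i)))
  (b := fun j => delta 0 (lshift q (rshift p j))) ulicq
  (fun i iN => delta0 _ (eq_ind_r (fun t => t != 0) iN
    (etrans (row_mxEl _ _ _ _) (row_mxEl _ _ _ _))))
  (fun j jN => delta0 _ (eq_ind_r (fun t => t != 0) jN
    (etrans (row_mxEl _ _ _ _) (row_mxEr _ _ _ _)))) sum0.
by apply/rowP => k; rewrite [RHS]mxE; elim/ord3_ind: k => k.
Qed.

End Bilevel.

Theorem theorem5p2 (R : realType) (n m p q : nat)
  (F f : 'rV[R]_n -> 'rV[R]_m -> R)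
  (G : 'rV[R]_n -> 'rV[R]_m -> 'rV[R]_p)
  (g : 'rV[R]_n -> 'rV[R]_m -> 'rV[R]_q)
  (F_C2 : twice_cont_diff (uncur F))
  (f_C2 : twice_cont_diff (uncur f))
  (G_C2 : forall i, twice_cont_diff (uncur (cpt G i)))
  (g_C2 : forall j, twice_cont_diff (uncur (cpt g j)))
  (lambda : R) (lambda_gt0 : 0 < lambda)
  (x : 'rV[R]_n) (y z : 'rV[R]_m)
  (u : 'rV[R]_p) (v w : 'rV[R]_q)
  (zeta_stationary : stationary F f G g lambda x y z u v w)
  (ulicq : ULICQ G g x y)
  (llicq : LLICQ g x z)
  (second_order : forall d : 'rV[R]_(n + m + m),
    Qset G g x y z u v w d -> d <> 0 ->
    quadf (hess (uncur (fun x' y' => calL F f G g lambda x' y' u v))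
                (row_mx x y)) (d12 d) >
    lambda * quadf (hess (uncur (fun x' z' => ell f g x' z' w))
                         (row_mx x z)) (d13 d))
  (lscc : LSCC g x z w) :
  CD_regular (Phi F f G g lambda) (zeta_of x y z u v w).
Proof.
have [_ cu cv cw] := zeta_stationary.
have F2 := twice_cont_diff_C2 F_C2; have f2 := twice_cont_diff_C2 f_C2.
have G2 i := twice_cont_diff_C2 (G_C2 i).
have g2 j := twice_cont_diff_C2 (g_C2 j).
have conE : constraints G g (row_mx (row_mx x y) z) =
    row_mx (row_mx (G x y) (g x y)) (g x z).
  by rewrite /constraints /uncur /= /d13 !row_mxKl !row_mxKr.
have cle0 k : constraints G g (row_mx (row_mx x y) z) 0 k <= 0.
  have [[_ Gle0 _] [_ gle0 _] [_ gle0' _]] := And3 cu cv cw.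
  by rewrite conE; elim/ord3_ind: k => k; rewrite ?row_mxEl ?row_mxEr.
rewrite Phi_kkt_map; apply: kkt_map_CD_regular.
- exact: objective_C2.
- exact: constraints_C2.
- have [[u0 _ _] [v0 _ _] [w0 _ _]] := And3 cu cv cw.
  by move=> k; elim/ord3_ind: k => k; rewrite ?row_mxEl ?row_mxEr.
- exact: cle0.
- move=> k; rewrite conE; elim/ord3_ind: k => k.
  + by rewrite !row_mxEl; exact: complementary_slack.
  + by rewrite !row_mxEl !row_mxEr; exact: complementary_slack.
  + by rewrite !row_mxEr; exact: complementary_slack.
(* The first two blocks have weight 1, so a negative weight occurs only in the third, where [lscc]
   excludes biactive indices. *)
- move=> k; rewrite conE; elim/ord3_ind: k => k.
  + by rewrite weights_G ltr10.
  + by rewrite weights_g_y ltr10.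
  + rewrite !row_mxEr => _ wg0.
    by have : [set j | w 0 j = 0 /\ g x z 0 j = 0] k by []; rewrite lscc.
(* Indices in [nu] have a positive multiplier, so [dQ] yields each equation defining [Qset]. *)
- move=> d dQ dN0; rewrite derive2_wlag_bilevel// subr_gt0.
  apply: second_order => //; split=> j [muj _].
  + rewrite dotv_grad; last by have [h _ _] := G2 j; exact: h.
    have := dQ (lshift q (lshift q j)).
    by rewrite derive_constraints !row_mxEl mxE; apply.
  + rewrite dotv_grad; last by have [h _ _] := g2 j; exact: h.
    have := dQ (lshift q (rshift p j)).
    by rewrite derive_constraints !row_mxEl !row_mxEr mxE; apply.
  + rewrite dotv_grad; last by have [h _ _] := g2 j; exact: h.
    have := dQ (rshift (p + q) j).
    by rewrite derive_constraints !row_mxEr mxE; apply.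
- by move=> delta inact; exact: bilevel_licq.
Qed.
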